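(* Let $(X,\mathcal{E})$ and $(Y,\mathcal{F})$ be coarse spaces. Let $Z=X\times Y$ with the product coarse structure. (1) If $X$ and $Y$ have finite weak coarse decomposition complexity, then so does $Z$. (2) If $X$ and $Y$ have finite coarse decomposition complexity, then so does $Z$. (3) If $X$ and $Y$ have straight finite coarse decomposition complexity, then so does $Z$.
   Context: A coarse structure on a set $X$ is a collection $\mathcal{E}$ of subsets of $X\times X$, called entourages, closed under subsets, finite unions, inverses $E^{-1}=\{(y,x)\mid (x,y)\in E\}$ and compositions $E_1\circ E_2=\{(x,z)\mid \exists y,\ (x,y)\in E_1,\ (y,z)\in E_2\}$, and containing the diagonal $\Delta_X$. The pair $(X,\mathcal{E})$ is a coarse space; subsets carry the restricted coarse structure. A family $\mathcal{U}$ of subsets is uniformly bounded if $\bigcup_{U\in\mathcal{U}}(U\times U)\in\mathcal{E}$. The product coarse structure on $X_1\times\cdots\times X_k$, for coarse spaces $(X_i,\mathcal{E}_i)$, is $\{E\subseteq(X_1\times\cdots\times X_k)^2\mid (p_i\times p_i)(E)\in\mathcal{E}_i\ \forall i\}$, where $p_i$ is the projection to the $i$-th factor. Let $\mathcal{X},\mathcal{Y}$ be families of subsets of $X$ and $L\in\mathcal{E}$. For an integer $d\ge1$, a weak $(L,d)$-decomposition of a set $W$ over $\mathcal{Y}$ is an expression $W=W^1\cup\cdots\cup W^d$ where each $W^i=\bigcup_j W^i_j$ with all $W^i_j\in\mathcal{Y}$, and, for each $i$, $W^i_j\ne W^i_{j'}$ implies $(W^i_j\times W^i_{j'})\cap L=\emptyset$.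 An $L$-decomposition is a weak $(L,2)$-decomposition. The family $\mathcal{X}$ admits an $L$-decomposition (resp. weak $(L,d)$-decomposition) over $\mathcal{Y}$ if every $W\in\mathcal{X}$ does; write $\mathcal{X}\xrightarrow{L}\mathcal{Y}$ for the former. Coarse decomposition game for $X$: set $\mathcal{Y}_0=\{X\}$. In round $i\ge1$, Player 1 asserts an entourage $L_i$ and Player 2 responds with a family $\mathcal{Y}_i$ of subsets and an $L_i$-decomposition of $\mathcal{Y}_{i-1}$ over $\mathcal{Y}_i$. Player 2 wins if at some finite stage $\mathcal{Y}_i$ is uniformly bounded. In the weak coarse decomposition game, Player 2 instead responds with a positive integer $d_i$, a family $\mathcal{Y}_i$ and a weak $(L_i,d_i)$-decomposition of $\mathcal{Y}_{i-1}$ over $\mathcal{Y}_i$. The space $X$ has finite (resp. finite weak) coarse decomposition complexity if Player 2 has a winning strategy in the (resp. weak) game. It has straight finite coarse decomposition complexity if for any sequence of entourages $L_1\subseteq L_2\subseteq\cdots$ there is a finite sequence of families $\mathcal{Y}_1,\ldots,\mathcal{Y}_n$ of subsets of $X$ such that, with $\mathcal{Y}_0=\{X\}$, $\mathcal{Y}_{i-1}\xrightarrow{L_i}\mathcal{Y}_i$ for $i=1,\ldots,n$ and $\mathcal{Y}_n$ is uniformly bounded. *)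

(* Defs.v *)
From mathcomp Require Import all_boot.
From mathcomp Require Import boolp classical_sets.

Set Implicit Arguments.
Unset Strict Implicit.
Unset Printing Implicit Defensive.

Local Open Scope classical_set_scope.
Local Open Scope relation_scope.

Record coarse_structure (X : Type) := CoarseStructure {
  entourages :> set (X * X) -> Prop;
  entourage_diag : entourages diagonal;
  entourage_sub : forall E F : set (X * X),
    F `<=` E -> entourages E -> entourages F;
  entourageU : forall E F : set (X * X),
    entourages E -> entourages F -> entourages (E `|` F);
  entourageV : forall E : set (X * X), entourages E -> entourages (E^-1);
  entourage_comp : forall E F : set (X * X),
    entourages E -> entourages F -> entourages (E \; F)
}.

Definition uniformly_bounded (X : Type) (E : coarse_structure X)
    (U : set (set X)) : Prop :=
  E (\bigcup_(A in U) (A `*` A)).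

Section ProductCoarseStructure.
Variables (X Y : Type) (E : coarse_structure X) (F : coarse_structure Y).

Definition proj1sq (p : (X * Y) * (X * Y)) : X * X := (p.1.1, p.2.1).
Definition proj2sq (p : (X * Y) * (X * Y)) : Y * Y := (p.1.2, p.2.2).

Definition prod_entourages (G : set ((X * Y) * (X * Y))) : Prop :=
  E (proj1sq @` G) /\ F (proj2sq @` G).

Fact prod_entourage_diag : prod_entourages diagonal.
Proof.
split; [apply: (entourage_sub _ (entourage_diag E))
  | apply: (entourage_sub _ (entourage_diag F))];
  by move=> _ [[p q] pq <-]; rewrite /diagonal /= in pq *; rewrite pq.
Qed.

Fact prod_entourage_sub (G H : set ((X * Y) * (X * Y))) :
  H `<=` G -> prod_entourages G -> prod_entourages H.
Proof.
move=> HG [GE GF]; split; [apply: (entourage_sub _ GE)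
  | apply: (entourage_sub _ GF)]; exact: image_subset.
Qed.

Fact prod_entourageU (G H : set ((X * Y) * (X * Y))) :
  prod_entourages G -> prod_entourages H -> prod_entourages (G `|` H).
Proof.
by move=> [GE GF] [HE HF]; split; rewrite image_setU; apply: entourageU.
Qed.

Fact prod_entourageV (G : set ((X * Y) * (X * Y))) :
  prod_entourages G -> prod_entourages (G^-1).
Proof.
move=> [GE GF]; split; [apply: (entourage_sub _ (entourageV GE))
  | apply: (entourage_sub _ (entourageV GF))];
  by move=> _ [[p q] /= Gqp <-]; exists (q, p).
Qed.

Fact prod_entourage_comp (G H : set ((X * Y) * (X * Y))) :
  prod_entourages G -> prod_entourages H -> prod_entourages (G \; H).
Proof.
move=> [GE GF] [HE HF]; split.
- apply: (entourage_sub _ (entourage_comp GE HE)).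
  move=> _ [[p q] [r /= Gpr Hrq] <-].
  by exists r.1; [exists (p, r) | exists (r, q)].
- apply: (entourage_sub _ (entourage_comp GF HF)).
  move=> _ [[p q] [r /= Gpr Hrq] <-].
  by exists r.2; [exists (p, r) | exists (r, q)].
Qed.

Definition prod_coarse : coarse_structure (X * Y) :=
  CoarseStructure prod_entourage_diag prod_entourage_sub prod_entourageU
    prod_entourageV prod_entourage_comp.

End ProductCoarseStructure.

Section Decomposition.
Variable X : Type.
Implicit Types (L : set (X * X)) (W : set X) (Xs Ys : set (set X)).

(* [P i] is the set of pieces [{W^i_j | j}], so that [W^i] is their union.
   Since the separation condition only concerns pieces that differ as sets,
   nothing is lost by forgetting the index [j]. *)
Definition is_weak_decomposition L (d : nat) Ys W (P : 'I_d -> set (set X)) :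
    Prop :=
  [/\ W = \bigcup_(i in [set: 'I_d]) \bigcup_(A in P i) A,
      forall i, P i `<=` Ys
    & forall i A B, P i A -> P i B -> A <> B -> (A `*` B) `&` L = set0].

Definition admits_weak_decomposition L (d : nat) Xs Ys : Prop :=
  forall W, Xs W ->
    exists P : 'I_d -> set (set X), is_weak_decomposition L Ys W P.

Definition admits_decomposition L Xs Ys : Prop :=
  admits_weak_decomposition L 2 Xs Ys.

End Decomposition.

Section Game.
Variables (X : Type) (E : coarse_structure X).

(* Only the values of [resp_dec] on the members of the previous family
   matter. *)
Record response := Response {
  resp_dim : nat;
  resp_fam : set (set X);
  resp_dec : set X -> 'I_resp_dim -> set (set X)
}.

Arguments resp_dec : clear implicits.

(* A strategy of Player 2 maps [:: L_1; ...; L_i], Player 1's assertions so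
   far, to Player 2's answer in round i. *)
Definition strategy : Type := seq (set (X * X)) -> response.

(* Rounds are numbered from 1 but [L] from 0: [L i] is the entourage asserted
   in round [i.+1]. *)
Definition answer (s : strategy) (L : nat -> set (X * X)) (i : nat) :
    response :=
  s (mkseq L i.+1).

Definition game_family (s : strategy) (L : nat -> set (X * X)) (i : nat) :
    set (set X) :=
  if i is k.+1 then resp_fam (answer s L k) else [set [set: X]].

(* [D] is the set of numbers of colours that Player 2 may use. *)
Definition legal_response (D : set nat) (L : set (X * X))
    (Ys : set (set X)) (r : response) : Prop :=
  D (resp_dim r) /\
  forall W, Ys W -> is_weak_decomposition L (resp_fam r) W (resp_dec r W).

Definition winning_strategy (D : set nat) (s : strategy) : Prop :=
  forall L : nat -> set (X * X), (forall i, E (L i)) ->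
    exists n : nat,
      (forall i, (i < n)%N ->
         legal_response D (L i) (game_family s L i) (answer s L i)) /\
      uniformly_bounded E (game_family s L n).

Definition finite_coarse_decomposition_complexity : Prop :=
  exists s : strategy, winning_strategy [set 2%N] s.

Definition finite_weak_coarse_decomposition_complexity : Prop :=
  exists s : strategy, winning_strategy [set d | (0 < d)%N] s.

Definition straight_finite_coarse_decomposition_complexity : Prop :=
  forall L : nat -> set (X * X),
    (forall i, E (L i)) -> (forall i, L i `<=` L i.+1) ->
    exists (n : nat) (Ys : nat -> set (set X)),
      [/\ Ys 0 = [set [set: X]],
          forall i, (i < n)%N -> admits_decomposition (L i) (Ys i) (Ys i.+1)
        & uniformly_bounded E (Ys n)].

End Game.

(* Main.v *)
Require Import Defs.
From mathcomp Require Import all_boot.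
From mathcomp Require Import boolp classical_sets.

(** Play the game for X on the first coordinate, with the entourages projected
    to X and the families of all A x Y, until the family in X is uniformly
    bounded; from then on play the game for Y on the second coordinate, keeping
    the first one fixed.  Player 2 recognises the moment of switching from the
    history, as the first stage at which the family in X is uniformly bounded. *)

Set Implicit Arguments.
Unset Strict Implicit.
Unset Printing Implicit Defensive.

Local Open Scope classical_set_scope.

(** * Products of families, and concatenation of two sequences of families *)

Definition prod_family (X Y : Type) (As : set (set X)) (Bs : set (set Y)) :
    set (set (X * Y)) :=
  [set A `*` B | A in As & B in Bs].

Lemma prod_family_setT (X Y : Type) :
  prod_family [set [set: X]] [set [set: Y]] = [set [set: X * Y]].
Proof.
apply/seteqP; split=> [_ [_ -> [_ -> <-]]|_ ->]; first by rewrite setXTT.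
by exists [set: X] => //; exists [set: Y] => //; rewrite setXTT.
Qed.

Lemma uniformly_bounded_prod (X Y : Type)
    (E : coarse_structure X) (F : coarse_structure Y)
    (As : set (set X)) (Bs : set (set Y)) :
  uniformly_bounded E As -> uniformly_bounded F Bs ->
  uniformly_bounded (prod_coarse E F) (prod_family As Bs).
Proof.
move=> bA bB; split.
- apply: (entourage_sub _ bA) => _ [[p q] [_ [A AsA [B _ <-]]] + <-].
  by move=> [[? _] [? _]]; exists A.
- apply: (entourage_sub _ bB) => _ [[p q] [_ [A _ [B BsB <-]]] + <-].
  by move=> [[_ ?] [_ ?]]; exists B.
Qed.

(** Each piece of A is multiplied by the same B. A pair of [L] joining two such products projects to
    a pair joining their first factors, so separation is inherited from [X] with the same number of
    colours. *)
Lemma admits_weak_decomposition_prodl (X Y : Type)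
    (L : set ((X * Y) * (X * Y))) (d : nat)
    (As As' : set (set X)) (Bs : set (set Y)) :
  admits_weak_decomposition ((@proj1sq X Y) @` L) d As As' ->
  admits_weak_decomposition L d (prod_family As Bs) (prod_family As' Bs).
Proof.
move=> dec _ [A AsA [B BsB <-]]; have [P [defA subP sepP]] := dec _ AsA.
exists (fun i => [set C `*` B | C in P i]); split.
- rewrite {1}defA; apply/seteqP; split=> [[x y] [[i _ [C PC Cx]] By]|[x y]].
    by exists i => //; exists (C `*` B) => //; exists C.
  by move=> [i _ [_ [C PC <-]] [Cx By]]; split=> //; exists i => //; exists C.
- by move=> i _ [C PC <-]; exists C; [exact: subP PC | exists B].
- move=> i _ _ [C PC <-] [C' PC' <-] neqCC'; apply/seteqP; split=> // -[p q].
  move=> [[[Cp _] [C'q _]] Lpq].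
  (* The second factor [B] is common, so distinct products have distinct first factors. *)
  have {}neqCC' : C <> C' by move=> eqCC'; apply: neqCC'; rewrite eqCC'.
  have /seteqP[/(_ (p.1, q.1)) + _] := sepP i _ _ PC PC' neqCC'.
  by apply; split=> //; exists (p, q).
Qed.

Lemma admits_weak_decomposition_prodr (X Y : Type)
    (L : set ((X * Y) * (X * Y))) (d : nat)
    (As : set (set X)) (Bs Bs' : set (set Y)) :
  admits_weak_decomposition ((@proj2sq X Y) @` L) d Bs Bs' ->
  admits_weak_decomposition L d (prod_family As Bs) (prod_family As Bs').
Proof.
move=> dec _ [A AsA [B BsB <-]]; have [P [defB subP sepP]] := dec _ BsB.
exists (fun i => [set A `*` C | C in P i]); split.
- rewrite {1}defB; apply/seteqP; split=> [[x y] [Ax [i _ [C PC Cy]]]|[x y]].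
    by exists i => //; exists (A `*` C) => //; exists C.
  by move=> [i _ [_ [C PC <-]] [Ax Cy]]; split=> //; exists i => //; exists C.
- by move=> i _ [C PC <-]; exists A => //; exists C => //; exact: subP PC.
- move=> i _ _ [C PC <-] [C' PC' <-] neqCC'; apply/seteqP; split=> // -[p q].
  move=> [[[_ Cp] [_ C'q]] Lpq].
  have {}neqCC' : C <> C' by move=> eqCC'; apply: neqCC'; rewrite eqCC'.
  have /seteqP[/(_ (p.2, q.2)) + _] := sepP i _ _ PC PC' neqCC'.
  by apply; split=> //; exists (p, q).
Qed.

(* The truncated subtraction keeps the second family at its start during the
   first [m] rounds. *)
Definition concat_family (X Y : Type) (m : nat)
    (Xs : nat -> set (set X)) (Ys : nat -> set (set Y)) (k : nat) :=
  prod_family (Xs (minn k m)) (Ys (k - m)).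

(** Exactly one factor is decomposed in each round, and round [i] for [Y] is round [m + i] of the
    whole. Letting the colour numbers vary with the round covers both the straight case and the
    games. *)
Lemma concat_family_step (X Y : Type) (L : nat -> set ((X * Y) * (X * Y)))
    (m n : nat) (dX dY : nat -> nat)
    (Xs : nat -> set (set X)) (Ys : nat -> set (set Y)) :
  (forall i, i < m -> admits_weak_decomposition
     ((@proj1sq X Y) @` L i) (dX i) (Xs i) (Xs i.+1)) ->
  (forall i, i < n -> admits_weak_decomposition
     ((@proj2sq X Y) @` L (m + i)) (dY i) (Ys i) (Ys i.+1)) ->
  forall k, k < m + n -> admits_weak_decomposition
    (L k) (if k < m then dX k else dY (k - m))
    (concat_family m Xs Ys k) (concat_family m Xs Ys k.+1).
Proof.
move=> stepX stepY k ltk; rewrite /concat_family; case: ltnP => [ltkm|lemk].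
  rewrite (minn_idPl ltkm).
  (* Both [k.+1 - m] and [k - m] are 0, so the second family is [Ys 0] before and after the
     round. *)
  move: (ltkm) (ltnW ltkm); rewrite -!subn_eq0 => /eqP-> /eqP->.
  exact/admits_weak_decomposition_prodl/stepX.
rewrite (minn_idPr (leqW lemk)) subSn //.
apply: admits_weak_decomposition_prodr.
by rewrite -{1}(subnKC lemk); apply: stepY; rewrite ltn_subLR.
Qed.

Lemma uniformly_bounded_concat (X Y : Type)
    (E : coarse_structure X) (F : coarse_structure Y) (m n : nat)
    (Xs : nat -> set (set X)) (Ys : nat -> set (set Y)) :
  uniformly_bounded E (Xs m) -> uniformly_bounded F (Ys n) ->
  uniformly_bounded (prod_coarse E F) (concat_family m Xs Ys (m + n)).
Proof.
move=> bX bY; rewrite /concat_family (minn_idPr (leq_addr n m)) addKn.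
exact: uniformly_bounded_prod.
Qed.

(** * Straight complexity *)

Lemma straight_finite_coarse_decomposition_complexity_prod (X Y : Type)
    (E : coarse_structure X) (F : coarse_structure Y) :
  straight_finite_coarse_decomposition_complexity E ->
  straight_finite_coarse_decomposition_complexity F ->
  straight_finite_coarse_decomposition_complexity (prod_coarse E F).
Proof.
move=> sX sY L EL incL.
have [||m [Xs [Xs0 stepX bX]]] := sX (fun i => (@proj1sq X Y) @` L i).
- by move=> i; have [] := EL i.
- by move=> i; apply: image_subset.
(* The sequence for [Y] is the tail of the projected entourages from [m] on, known once [X] has
   fixed [m] and still increasing. *)
have [||n [Ys [Ys0 stepY bY]]] := sY (fun i => (@proj2sq X Y) @` L (m + i)).
- by move=> i; have [] := EL (m + i).
- by move=> i; rewrite addnS; apply: image_subset.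
exists (m + n), (concat_family m Xs Ys); split.
- by rewrite /concat_family min0n Xs0 Ys0 prod_family_setT.
- move=> k ltk; rewrite /admits_decomposition.
  by have := concat_family_step stepX stepY ltk; rewrite if_same.
- exact: uniformly_bounded_concat.
Qed.

(** * Responses and strategies in the games *)

(** A response carries its decompositions as data, whereas for products only their existence is
    proved; choice supplies them. The default [set0] occurs only at sets that have no
    decomposition. *)
Definition chosen_response (X : Type) (L : set (X * X)) (d : nat)
    (Ys : set (set X)) : response X :=
  @Response X d Ys (fun W =>
    if pselect (exists P : 'I_d -> _, is_weak_decomposition L Ys W P)
    is left decW then sval (cid decW) else fun=> set0).

Lemma legal_chosen_response (X : Type) (D : set nat) (L : set (X * X))
    (d : nat) (Xs Ys : set (set X)) :
  D d -> admits_weak_decomposition L d Xs Ys ->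
  legal_response D L Xs (chosen_response L d Ys).
Proof.
move=> Dd dec; split=> // W XsW /=.
by case: pselect => [decW|/(_ (dec W XsW))//]; case: (cid decW).
Qed.

Lemma legal_response_admits (X : Type) (D : set nat) (L : set (X * X))
    (Xs : set (set X)) (r : response X) :
  legal_response D L Xs r ->
  admits_weak_decomposition L (resp_dim r) Xs (resp_fam r).
Proof. by move=> [_ dec] W /dec; exists (resp_dec W). Qed.

(** A strategy sees a finite history only, so infinite sequences with the same beginning are
    interchangeable. This justifies padding a history arbitrarily. *)
Lemma eq_answer (X : Type) (s : strategy X) (L L' : nat -> set (X * X)) k :
  (forall i, i <= k -> L i = L' i) -> answer s L k = answer s L' k.
Proof.
move=> eqL; congr s; apply/eq_in_map => i.
by rewrite mem_iota /= => /eqL.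
Qed.

Lemma eq_game_family (X : Type) (s : strategy X) (L L' : nat -> set (X * X)) k :
  (forall i, i < k -> L i = L' i) -> game_family s L k = game_family s L' k.
Proof. by case: k => // k eqL; rewrite /= (eq_answer s eqL). Qed.

Section ProductStrategy.
Variables (X Y : Type) (E : coarse_structure X).
Variables (sX : strategy X) (sY : strategy Y).
Implicit Type L : nat -> set ((X * Y) * (X * Y)).

Definition proj1_moves L i : set (X * X) := (@proj1sq X Y) @` L i.
Definition proj2_moves L m i : set (Y * Y) := (@proj2sq X Y) @` L (m + i).

Definition bounded_at L (j : nat) : bool :=
  `[< uniformly_bounded E (game_family sX (proj1_moves L) j) >].

(* Equals [k.+1] if the family in [X] is not yet uniformly bounded after [k]
   rounds. *)
Definition switch_time L (k : nat) : nat := find (bounded_at L) (iota 0 k.+1).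

Definition prod_dim L (m k : nat) : nat :=
  if k < m then resp_dim (answer sX (proj1_moves L) k)
  else resp_dim (answer sY (proj2_moves L m) (k - m)).

Definition prod_game_family L (m : nat) : nat -> set (set (X * Y)) :=
  concat_family m (game_family sX (proj1_moves L))
    (game_family sY (proj2_moves L m)).

(** The switching time [m] is a parameter, so that the value read off the history can be replaced by
    the true one. *)
Definition prod_response L (m k : nat) : response (X * Y) :=
  chosen_response (L k) (prod_dim L m k) (prod_game_family L m k.+1).

Definition prod_strategy : strategy (X * Y) := fun h =>
  (* The history is padded with [set0] to an infinite sequence; its last entry is the move of the
     current round [k]. *)
  let L := nth set0 h in
  let k := (size h).-1 in
  prod_response L (switch_time L k) k.

(** A failed [find] returns the length of the list, here [k.+1]; hence the minimum. *)
Lemma switch_timeE L m k :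
  bounded_at L m -> (forall j, bounded_at L j -> m <= j) ->
  switch_time L k = minn m k.+1.
Proof.
move=> bm minm; rewrite /switch_time.
have [lemk|ltkm] := leqP m k; last first.
  rewrite hasNfind ?size_iota; first by rewrite (minn_idPr ltkm).
  apply/hasPn => j; rewrite mem_iota /= add0n => ltjk.
  by apply: contraL ltkm => /minm lemj; rewrite -leqNgt (leq_trans lemj).
rewrite (minn_idPl (leqW lemk)); apply/eqP; rewrite eqn_leq.
have hasb : has (bounded_at L) (iota 0 k.+1).
  by apply/hasP; exists m; rewrite // mem_iota.
apply/andP; split; last first.
  have := nth_find 0 hasb; rewrite nth_iota ?add0n; first exact: minm.
  by rewrite -[ltnRHS](size_iota 0) -has_find.
rewrite leqNgt; apply/negP => /(before_find 0).
by rewrite nth_iota ?add0n ?bm.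
Qed.

(** Before the switch, round [k] uses only the fact that [k < m], so the truncated switching time
    yields the same response. *)
Lemma prod_response_minn L m k :
  prod_response L (minn m k.+1) k = prod_response L m k.
Proof.
have [lemk|ltkm] := leqP m k; first by rewrite (minn_idPl (leqW lemk)).
rewrite (minn_idPr ltkm) /prod_response /prod_dim ltnSn ltkm.
rewrite /prod_game_family /concat_family minnn subnn (minn_idPl ltkm).
(* The family in [Y] is at stage 0 on both sides, where the differing shifts in [proj2_moves] have
   no effect. *)
by move: ltkm; rewrite -subn_eq0 => /eqP->.
Qed.

Lemma eq_prod_response L L' m k : (forall i, i <= k -> L i = L' i) ->
  m <= k.+1 -> prod_response L m k = prod_response L' m k.
Proof.
move=> eqL lemk.
have eq1 i : i <= k -> proj1_moves L i = proj1_moves L' i.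
  by move=> /eqL; rewrite /proj1_moves => ->.
have eq2 i : m + i <= k -> proj2_moves L m i = proj2_moves L' m i.
  by move=> /eqL; rewrite /proj2_moves => ->.
have eqf : prod_game_family L m k.+1 = prod_game_family L' m k.+1.
  rewrite /prod_game_family /concat_family; congr prod_family;
    apply: eq_game_family => i.
    by rewrite (minn_idPr lemk) => /leq_trans/(_ lemk)/eq1.
  by rewrite ltn_subRL => /eq2.
have eqd : prod_dim L m k = prod_dim L' m k.
  rewrite /prod_dim; case: ltnP => [_|lemk']; first by rewrite (eq_answer _ eq1).
  congr resp_dim; apply: eq_answer => i leik; apply: eq2.
  by rewrite -(subnKC lemk') leq_add2l.
by rewrite /prod_response eqL // eqf eqd.
Qed.

Lemma answer_prod_strategy L m k :
  bounded_at L m -> (forall j, bounded_at L j -> m <= j) ->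
  answer prod_strategy L k = prod_response L m k.
Proof.
move=> bm minm; rewrite /answer /prod_strategy size_mkseq /=.
set L' := nth set0 _.
have eqL i : i <= k -> L' i = L i by move=> leik; rewrite /L' nth_mkseq.
(* Boundedness at a stage [j <= k] depends only on moves before [j], where the padded history agrees
   with [L]. *)
have -> : switch_time L' k = switch_time L k.
  apply: eq_in_find => j; rewrite mem_iota /= add0n ltnS => lejk.
  rewrite /bounded_at; congr asbool; congr uniformly_bounded.
  apply: eq_game_family => i ltij.
  by rewrite /proj1_moves eqL // ltnW // (leq_trans ltij).
rewrite (switch_timeE _ bm minm) -[RHS]prod_response_minn.
by apply: eq_prod_response => //; exact: geq_minr.
Qed.

Lemma game_family_prod_strategy L m k :
  bounded_at L m -> (forall j, bounded_at L j -> m <= j) ->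
  game_family prod_strategy L k = prod_game_family L m k.
Proof.
move=> bm minm; case: k => [|k]; last first.
  by rewrite [LHS]/(resp_fam _) (answer_prod_strategy _ bm minm).
by rewrite /prod_game_family /concat_family min0n /= prod_family_setT.
Qed.

(** Each response borrows its number of colours from [sX] or [sY], so it stays in [D]; one strategy
    thus serves both games. *)
Lemma winning_prod_strategy (F : coarse_structure Y) (D : set nat) :
  winning_strategy E D sX -> winning_strategy F D sY ->
  winning_strategy (prod_coarse E F) D prod_strategy.
Proof.
move=> winX winY L EL.
have [|n0 [legalX bX]] := winX (proj1_moves L); first by move=> i; have [] := EL i.
have exm : exists j, bounded_at L j by exists n0; apply/asboolP.
(* The play in [X] is cut at its first bounded stage, which may precede the stage [n0] provided by
   [winX]; legality is inherited because [m <= n0]. *)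
have [m bm minm] := ex_minnP exm.
have {bX} lemn0 : m <= n0 by apply/minm/asboolP.
have {}legalX i : i < m -> legal_response D (proj1_moves L i)
    (game_family sX (proj1_moves L) i) (answer sX (proj1_moves L) i).
  by move=> ltim; apply: legalX; exact: leq_trans lemn0.
have [|n [legalY bY]] := winY (proj2_moves L m).
  by move=> i; have [] := EL (m + i).
exists (m + n); split; last first.
  rewrite (game_family_prod_strategy _ bm minm).
  by apply: uniformly_bounded_concat bY; exact/asboolP.
move=> k ltk; rewrite (game_family_prod_strategy _ bm minm).
rewrite (answer_prod_strategy _ bm minm).
apply: legal_chosen_response.
  rewrite /prod_dim; case: ltnP => [/legalX[]//|lemk].
  by have [|] := legalY (k - m); rewrite ?ltn_subLR.
apply: (concat_family_step
  (dX := fun i => resp_dim (answer sX (proj1_moves L) i))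
  (dY := fun i => resp_dim (answer sY (proj2_moves L m) i))) ltk => i.
  by move=> /legalX; exact: legal_response_admits.
by move=> /legalY; exact: legal_response_admits.
Qed.

End ProductStrategy.

Theorem theorem4p17 (X Y : Type)
    (E : coarse_structure X) (F : coarse_structure Y) :
  (finite_weak_coarse_decomposition_complexity E ->
   finite_weak_coarse_decomposition_complexity F ->
   finite_weak_coarse_decomposition_complexity (prod_coarse E F)) /\
  (finite_coarse_decomposition_complexity E ->
   finite_coarse_decomposition_complexity F ->
   finite_coarse_decomposition_complexity (prod_coarse E F)) /\
  (straight_finite_coarse_decomposition_complexity E ->
   straight_finite_coarse_decomposition_complexity F ->
   straight_finite_coarse_decomposition_complexity (prod_coarse E F)).
Proof.
split; [|split; last exact: straight_finite_coarse_decomposition_complexity_prod].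
- move=> [sX winX] [sY winY]; exists (prod_strategy E sX sY).
  exact: winning_prod_strategy.
- move=> [sX winX] [sY winY]; exists (prod_strategy E sX sY).
  exact: winning_prod_strategy.
Qed.
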